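(* For all real $x>0$ and all $k\in\mathbb{N}$, the double inequality $$\frac{(k-1)!}{\Bigl\{x+\Bigl[\frac{(k-1)!}{\vert\psi^{(k)}(1)\vert}\Bigr]^{1/k}\Bigr\}^k}<\bigl\vert\psi^{(k)}(x+1)\bigr\vert<\frac{(k-1)!}{\bigl(x+\frac12\bigr)^k}$$ is valid, and the scalars $\Bigl[\frac{(k-1)!}{\vert\psi^{(k)}(1)\vert}\Bigr]^{1/k}$ (in the lower bound) and $\frac12$ (in the upper bound) are the best possible.
   Context: $\mathbb{N}=\{1,2,3,\dots\}$. For $x>0$, $\Gamma(x)=\int_0^\infty t^{x-1}e^{-t}\,dt$ is the Euler gamma function, $\psi(x)=\Gamma'(x)/\Gamma(x)$ is the psi (digamma) function, and $\psi^{(k)}$ denotes the $k$-th derivative of $\psi$ (the polygamma functions, $k\in\mathbb{N}$). The $1/k$-th power is the positive real $k$-th root. ''Best possible'' means, for each fixed $k\in\mathbb{N}$: if $\alpha\ge 0$ is a real number such that $\frac{(k-1)!}{(x+\alpha)^k}<\vert\psi^{(k)}(x+1)\vert$ for all $x>0$, then $\alpha\ge\bigl[\frac{(k-1)!}{\vert\psi^{(k)}(1)\vert}\bigr]^{1/k}$; and if $\beta\ge 0$ is a real number such that $\vert\psi^{(k)}(x+1)\vert<\frac{(k-1)!}{(x+\beta)^k}$ for all $x>0$, then $\beta\le\frac12$. *)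

(* Defs.v *)
From Stdlib Require Import Reals Arith.
From Coquelicot Require Import Coquelicot.
Open Scope R_scope.

(* [Gamma] and [psi] are meaningful for [0 < x] only; their values elsewhere
   are never used, since derivatives at a positive point are local. *)

(* The integral is improper at both ends: [0] is approached from the right
   because [t ^ (x - 1)] is unbounded there when [x < 1]. *)
Definition Gamma (x : R) : R :=
  RInt_gen (fun t => Rpower t (x - 1) * exp (- t))
    (at_right 0) (Rbar_locally p_infty).

Definition psi (x : R) : R := Derive Gamma x / Gamma x.

Definition polygamma (k : nat) (x : R) : R := Derive_n psi k x.

(* [Rpower] is the positive real root here, its base being positive. *)
Definition lower_shift (k : nat) : R :=
  Rpower (INR (fact (k - 1)) / Rabs (polygamma k 1)) (1 / INR k).

(* Main.v *)
Require Import Defs.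
From Stdlib Require Import Reals Arith Lra Lia Ranalysis5.
From Coquelicot Require Import Coquelicot.
Open Scope R_scope.

(* With g(t) = t / (e^t - 1) one has
   |psi^(k)(x+1)| = int_0^oo t^(k-1) e^(-xt) g(t) dt, while
   (k-1)! / (x+a)^k = int_0^oo t^(k-1) e^(-xt) e^(-at) dt.
   The upper bound is then g(t) < e^(-t/2), and 1/2 is optimal because
   g(t) >= 1 - t/2.  For the lower bound, let c be the shift for which the two
   integrals agree at x = 0.  Since -ln(g(t))/t is increasing, g(t) - e^(-ct)
   changes sign exactly once, from + to -, so inserting the decreasing weight
   e^(-xt) turns the equality at x = 0 into a strict inequality; optimality of c
   is immediate from x -> 0.
   The integral formula comes from Wendel's inequality
   Gamma(x+s) <= x^s Gamma(x) (0 <= s <= 1), which makes ln Gamma(x) the limit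
   of ln Gamma(n+1) + x ln(n+1) - sum_(j<=n) ln(x+j); a bound on the
   second derivatives allows this to be differentiated term by term. *)

(** * Integrals over the positive half-line *)

(** Both ends use the same filters as [Gamma], so uniqueness of limits transfers results to it. A
    relation, unlike a value, carries convergence with it. *)
Definition is_int (f : R -> R) (l : R) : Prop :=
  is_RInt_gen f (at_right 0) (Rbar_locally p_infty) l.

(** Zero is excluded because the integrands may be unbounded there, or may have a junk value there,
    as [t / (exp t - 1)] does. *)
Definition pos_continuous (f : R -> R) : Prop :=
  forall t : R, 0 < t -> continuous f t.

Lemma at_right_pos (P : R -> Prop) :
  at_right 0 P <-> exists d : R, 0 < d /\ forall a, 0 < a < d -> P a.
Proof.
split.
- intros [d Hd]; exists d; split; [apply cond_pos|].
  intros a Ha; apply Hd; [|lra].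
  unfold ball; simpl; unfold AbsRing_ball, abs, minus, plus, opp; simpl.
  rewrite Rabs_pos_eq; lra.
- intros [d [Hd HP]]; exists (mkposreal d Hd); intros a Ha Ha0; apply HP.
  unfold ball in Ha; simpl in Ha.
  unfold AbsRing_ball, abs, minus, plus, opp in Ha; simpl in Ha.
  rewrite Rabs_pos_eq in Ha; lra.
Qed.

Lemma filter_ends (P : R * R -> Prop) :
  (forall a b, 0 < a -> a < b -> P (a, b)) ->
  filter_prod (at_right 0) (Rbar_locally p_infty) P.
Proof.
intros HP; exists (fun a => 0 < a < 1) (fun b => 1 < b).
- apply at_right_pos; exists 1; split; [lra|]; intros; lra.
- exists 1; intros; lra.
- intros a b Ha Hb; apply HP; lra.
Qed.

Lemma ex_RInt_pos (f : R -> R) (a b : R) :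
  pos_continuous f -> 0 < a -> a <= b -> ex_RInt f a b.
Proof.
intros Hf Ha Hb; apply (ex_RInt_continuous (V := R_CompleteNormedModule)).
rewrite Rmin_left by lra; intros z Hz; apply Hf; lra.
Qed.

Lemma is_int_intro (f : R -> R) (l : R) :
  pos_continuous f ->
  (forall eps : R, 0 < eps -> exists d M : R, 0 < d /\
     forall a b, 0 < a < d -> M < b -> a < b -> Rabs (RInt f a b - l) < eps) ->
  is_int f l.
Proof.
intros Hf H P [eps HP].
destruct (H eps (cond_pos eps)) as [d [M [Hd HM]]].
(* Cutting both filters at 1 forces [a < 1 < b], which gives the ordering required by [HM]. *)
exists (fun a => 0 < a < Rmin d 1) (fun b => Rmax M 1 < b).
- apply at_right_pos; exists (Rmin d 1); split; [|tauto].
  apply Rmin_glb_lt; lra.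
- exists (Rmax M 1); tauto.
- intros a b [Ha Ha'] Hb; simpl.
  assert (Ha1 := Rlt_le_trans _ _ _ Ha' (Rmin_l _ _)).
  assert (Ha2 := Rlt_le_trans _ _ _ Ha' (Rmin_r _ _)).
  assert (Hb1 := Rle_lt_trans _ _ _ (Rmax_l _ _) Hb).
  assert (Hb2 := Rle_lt_trans _ _ _ (Rmax_r _ _) Hb).
  exists (RInt f a b); split.
  + apply (RInt_correct (V := R_CompleteNormedModule)).
    apply ex_RInt_pos; lra || auto.
  + apply HP; apply (HM a b); lra.
Qed.

Lemma is_int_elim (f : R -> R) (l eps : R) :
  is_int f l -> 0 < eps ->
  exists d M : R, 0 < d /\
    forall a b, 0 < a < d -> M < b -> Rabs (RInt f a b - l) < eps.
Proof.
intros H He.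
destruct (H (fun y => Rabs (y - l) < eps)) as [P Q HP [M HM] HPQ].
{ exists (mkposreal eps He); intros y Hy; exact Hy. }
apply at_right_pos in HP; destruct HP as [d [Hd HP]].
exists d, M; split; [exact Hd|]; intros a b Ha Hb.
destruct (HPQ a b (HP a Ha) (HM b Hb)) as [y [Hy Hyl]]; simpl in Hy.
now rewrite (is_RInt_unique f a b y Hy).
Qed.

Lemma is_int_unique (f : R -> R) (l1 l2 : R) :
  is_int f l1 -> is_int f l2 -> l1 = l2.
Proof.
intros H1 H2.
rewrite <- (is_RInt_gen_unique f l1 H1); exact (is_RInt_gen_unique f l2 H2).
Qed.

Lemma is_int_ext (f g : R -> R) (l : R) :
  (forall t, 0 < t -> f t = g t) -> is_int f l -> is_int g l.
Proof.
intros Hfg; apply is_RInt_gen_ext; apply filter_ends; simpl; intros a b Ha Hb t.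
rewrite Rmin_left by lra; intros Ht; apply Hfg; lra.
Qed.

Lemma is_int_plus (f g : R -> R) (l1 l2 : R) :
  is_int f l1 -> is_int g l2 -> is_int (fun t => f t + g t) (l1 + l2).
Proof. exact (is_RInt_gen_plus f g l1 l2). Qed.

Lemma is_int_minus (f g : R -> R) (l1 l2 : R) :
  is_int f l1 -> is_int g l2 -> is_int (fun t => f t - g t) (l1 - l2).
Proof. exact (is_RInt_gen_minus f g l1 l2). Qed.

Lemma is_int_scal (f : R -> R) (c l : R) :
  is_int f l -> is_int (fun t => c * f t) (c * l).
Proof. exact (is_RInt_gen_scal f c l). Qed.

Lemma RInt_incl_le (f : R -> R) (a b a' b' : R) :
  pos_continuous f -> (forall t, 0 < t -> 0 <= f t) ->
  0 < a' -> a' <= a -> a <= b -> b <= b' -> RInt f a b <= RInt f a' b'.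
Proof.
intros Hf Hp Ha' Ha Hab Hb.
assert (E := fun u v => ex_RInt_pos f u v Hf).
assert (P : forall u v, 0 < u -> u <= v -> 0 <= RInt f u v).
{ intros u v Hu Hv; apply RInt_ge_0; auto; intros t Ht; apply Hp; lra. }
rewrite <- (RInt_Chasles f a' a b') by (apply E; lra).
rewrite <- (RInt_Chasles f a b b') by (apply E; lra).
unfold plus; simpl.
generalize (P a' a Ha' Ha) (P b b' ltac:(lra) Hb); lra.
Qed.

(** For a nonnegative integrand a partial integral above [l] stays exceeded on every larger
    interval, which contradicts convergence to [l]. *)
Lemma RInt_le_is_int (f : R -> R) (l a b : R) :
  pos_continuous f -> (forall t, 0 < t -> 0 <= f t) ->
  is_int f l -> 0 < a -> a <= b -> RInt f a b <= l.
Proof.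
intros Hf Hp Hl Ha Hab; apply Rnot_lt_le; intros Hlt.
destruct (is_int_elim f l (RInt f a b - l) Hl) as [d [M [Hd HM]]]; [lra|].
set (a' := Rmin a (d / 2)); set (b' := Rmax b (M + 1)).
assert (H1 : 0 < a') by (apply Rmin_glb_lt; lra).
assert (H2 : a' <= a) by apply Rmin_l.
assert (H3 : a' <= d / 2) by apply Rmin_r.
assert (H4 : b <= b') by apply Rmax_l.
assert (H5 : M + 1 <= b') by apply Rmax_r.
specialize (HM a' b' ltac:(lra) ltac:(lra)).
assert (H6 := RInt_incl_le f a b a' b' Hf Hp H1 H2 Hab H4).
apply Rabs_def2 in HM; lra.
Qed.

Lemma is_int_ge_0 (f : R -> R) (l : R) :
  pos_continuous f -> (forall t, 0 < t -> 0 <= f t) -> is_int f l -> 0 <= l.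
Proof.
intros Hf Hp Hl.
apply Rle_trans with (RInt f 1 2); [|apply RInt_le_is_int; auto; lra].
apply RInt_ge_0; [lra|apply ex_RInt_pos; auto; lra|]; intros t Ht; apply Hp; lra.
Qed.

Lemma is_int_gt_0 (f : R -> R) (l a b : R) :
  pos_continuous f -> (forall t, 0 < t -> 0 <= f t) -> is_int f l ->
  0 < a -> a < b -> (forall t, a < t < b -> 0 < f t) -> 0 < l.
Proof.
intros Hf Hp Hl Ha Hab Hlt.
apply Rlt_le_trans with (RInt f a b); [|apply RInt_le_is_int; auto; lra].
apply RInt_gt_0; auto; intros t Ht; apply Hf; lra.
Qed.

Lemma pos_continuous_minus (f g : R -> R) :
  pos_continuous f -> pos_continuous g -> pos_continuous (fun t => f t - g t).
Proof.
intros Hf Hg t Ht.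
apply (continuous_minus (V := R_NormedModule) f g t (Hf t Ht) (Hg t Ht)).
Qed.

Lemma is_int_le (f g : R -> R) (l1 l2 : R) :
  pos_continuous f -> pos_continuous g -> (forall t, 0 < t -> f t <= g t) ->
  is_int f l1 -> is_int g l2 -> l1 <= l2.
Proof.
intros Hf Hg Hle H1 H2.
assert (H := is_int_ge_0 _ _ (pos_continuous_minus g f Hg Hf)
  ltac:(intros t Ht; specialize (Hle t Ht); lra) (is_int_minus g f _ _ H2 H1)).
lra.
Qed.

Lemma is_int_lt (f g : R -> R) (l1 l2 : R) :
  pos_continuous f -> pos_continuous g -> (forall t, 0 < t -> f t < g t) ->
  is_int f l1 -> is_int g l2 -> l1 < l2.
Proof.
intros Hf Hg Hlt H1 H2.
assert (H : 0 < l2 - l1); [|lra].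
apply (is_int_gt_0 (fun t => g t - f t) _ 1 2);
  [now apply pos_continuous_minus| |now apply is_int_minus|lra|lra|];
  intros t Ht; assert (H := Hlt t ltac:(lra)); lra.
Qed.

(** The integrals over compact intervals grow with the interval, so their supremum is the limit. *)
Lemma ex_is_int_bounded (f : R -> R) (B : R) :
  pos_continuous f -> (forall t, 0 < t -> 0 <= f t) ->
  (forall a b, 0 < a -> a <= b -> RInt f a b <= B) -> exists l, is_int f l.
Proof.
intros Hf Hp HB.
destruct (completeness (fun y => exists a b, 0 < a /\ a <= b /\ y = RInt f a b))
  as [S [HS1 HS2]].
- exists B; intros y [a [b [Ha [Hb ->]]]]; auto.
- exists (RInt f 1 1), 1, 1; repeat split; lra.
- exists S; apply is_int_intro; auto; intros eps He.
  assert (H : exists a b, 0 < a /\ a <= b /\ S - eps < RInt f a b).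
  { apply Classical_Prop.NNPP; intros Hn.
    assert (S <= S - eps); [|lra].
    apply HS2; intros y [a [b [Ha [Hb ->]]]].
    apply Rnot_lt_le; intros Hlt; apply Hn; exists a, b; auto. }
  destruct H as [a0 [b0 [Ha0 [Hab Hlt]]]].
  exists a0, b0; split; [exact Ha0|]; intros a b Ha Hb Hab'.
  assert (H1 := RInt_incl_le f a0 b0 a b Hf Hp ltac:(lra) ltac:(lra) Hab ltac:(lra)).
  assert (H2 : RInt f a b <= S) by (apply HS1; exists a, b; repeat split; lra).
  apply Rabs_def1; lra.
Qed.

Lemma ex_is_int_dominated (f g : R -> R) (l : R) :
  pos_continuous f -> pos_continuous g ->
  (forall t, 0 < t -> 0 <= f t <= g t) -> is_int g l -> exists l', is_int f l'.
Proof.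
intros Hf Hg Hfg Hl; apply (ex_is_int_bounded f l); auto.
- intros t Ht; apply Hfg; auto.
- intros a b Ha Hab; apply Rle_trans with (RInt g a b).
  + apply RInt_le; auto using ex_RInt_pos; intros t Ht; apply Hfg; lra.
  + apply RInt_le_is_int; auto; intros t Ht; specialize (Hfg t Ht); lra.
Qed.

Lemma is_int_derive (F f : R -> R) (l0 l1 : R) :
  (forall t, 0 < t -> is_derive F t (f t)) -> pos_continuous f ->
  filterlim F (at_right 0) (locally l0) ->
  filterlim F (Rbar_locally p_infty) (locally l1) -> is_int f (l1 - l0).
Proof.
intros HF Hf H0 H1; apply is_int_intro; auto; intros eps He.
assert (He2 : 0 < eps / 2) by lra.
assert (Hloc : forall l, locally l (fun y : R => Rabs (y - l) < eps / 2)).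
{ intros l; exists (mkposreal _ He2); intros y Hy; exact Hy. }
specialize (H0 _ (Hloc l0)); specialize (H1 _ (Hloc l1)).
apply at_right_pos in H0; destruct H0 as [d [Hd Hd']]; destruct H1 as [M HM].
exists d, M; split; [exact Hd|]; intros a b Ha Hb Hab.
replace (RInt f a b) with (F b - F a).
- specialize (Hd' a Ha); specialize (HM b Hb); simpl in *.
  apply Rabs_def2 in Hd'; apply Rabs_def2 in HM; apply Rabs_def1; lra.
- symmetry; apply is_RInt_unique.
  apply (is_RInt_derive (V := R_CompleteNormedModule) F f a b);
  rewrite Rmin_left by lra; intros t Ht; [apply HF|apply Hf]; lra.
Qed.

(** * The gamma function *)

Lemma filterlim_right_0 (F : R -> R) (l : R) :
  (forall eps, 0 < eps -> exists d, 0 < d /\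
     forall t, 0 < t < d -> Rabs (F t - l) < eps) ->
  filterlim F (at_right 0) (locally l).
Proof.
intros H P [eps HP]; apply at_right_pos.
destruct (H eps (cond_pos eps)) as [d [Hd Hd']].
exists d; split; [exact Hd|]; intros t Ht; apply HP; exact (Hd' t Ht).
Qed.

Lemma filterlim_p_infty_inv (F : R -> R) (l K : R) :
  (forall t, 0 < t -> Rabs (F t - l) <= K / t) ->
  filterlim F (Rbar_locally p_infty) (locally l).
Proof.
intros H P [eps HP]; exists (Rmax 0 (K / eps)); intros t Ht; apply HP.
assert (He := cond_pos eps).
assert (Ht0 := Rle_lt_trans _ _ _ (Rmax_l _ _) Ht).
assert (Ht1 := Rle_lt_trans _ _ _ (Rmax_r _ _) Ht).
apply Rle_lt_trans with (K / t); [now apply H|].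
apply (Rmult_lt_reg_r (t / eps)); [apply Rdiv_lt_0_compat; lra|].
replace (K / t * (t / eps)) with (K / eps) by (field; lra).
replace (eps * (t / eps)) with t by (field; lra); exact Ht1.
Qed.

Lemma Rpower_minus_1 (t x : R) : 0 < t -> Rpower t (x - 1) = Rpower t x / t.
Proof.
intros Ht; unfold Rminus; rewrite Rpower_plus, Rpower_Ropp, Rpower_1 by lra.
reflexivity.
Qed.

(** The constant is the maximum of t^y e^(-at), attained at t = y/a. It comes from ln r <= r - 1 at
    r = at/y. *)
Lemma Rpower_le_exp (y a t : R) : 0 < y -> 0 < a -> 0 < t ->
  Rpower t y <= exp (y * ln (y / a) - y) * exp (a * t).
Proof.
intros Hy Ha Ht; rewrite <- exp_plus; unfold Rpower.

assert (Hr : 0 < a * t / y) by (apply Rdiv_lt_0_compat; nra).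
assert (H : ln (a * t / y) <= a * t / y - 1).
{ generalize (exp_ineq1_le (ln (a * t / y))); rewrite exp_ln by auto; lra. }
assert (E : ln t = ln (y / a) + ln (a * t / y)).
{ rewrite <- ln_mult; [f_equal; field; lra|apply Rdiv_lt_0_compat; lra|exact Hr]. }
assert (H' : y * ln (a * t / y) <= a * t - y).
{ replace (a * t - y) with (y * (a * t / y - 1)) by (field; lra).
  apply Rmult_le_compat_l; lra. }
assert (H2 : y * ln t <= y * ln (y / a) - y + a * t) by (rewrite E; lra).
destruct H2 as [H2| ->]; [left; now apply exp_increasing|right; reflexivity].
Qed.

Lemma filterlim_Rpower_exp_p_infty (y : R) : 0 < y ->
  forall a, 0 < a ->
  filterlim (fun t => Rpower t y * exp (- (a * t))) (Rbar_locally p_infty) (locally 0).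
Proof.
intros Hy a Ha.
(* Bounding t^(y+1) instead of t^y leaves a spare factor 1/t. *)
apply filterlim_p_infty_inv with (exp ((y + 1) * ln ((y + 1) / a) - (y + 1))).
intros t Ht; rewrite Rminus_0_r.
assert (Hp : 0 < Rpower t y) by apply exp_pos.
assert (He := exp_pos (- (a * t))).
rewrite Rabs_pos_eq by nra.
apply (Rmult_le_reg_r (t * exp (a * t))); [apply Rmult_lt_0_compat; auto using exp_pos|].
replace (Rpower t y * exp (- (a * t)) * (t * exp (a * t)))
  with ((Rpower t y * t) * (exp (- (a * t)) * exp (a * t))) by ring.
rewrite <- exp_plus, Rplus_opp_l, exp_0, Rmult_1_r.
rewrite <- (Rpower_1 t) at 2 by lra; rewrite <- Rpower_plus.
eapply Rle_trans; [apply (Rpower_le_exp (y + 1) a t); lra|].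
right; field; lra.
Qed.

Lemma filterlim_Rpower_exp_0 (y a : R) : 0 < y -> 0 < a ->
  filterlim (fun t => Rpower t y * exp (- (a * t))) (at_right 0) (locally 0).
Proof.
intros Hy Ha; apply filterlim_right_0; intros eps He.
exists (Rpower eps (/ y)); split; [apply exp_pos|]; intros t Ht.
rewrite Rminus_0_r.
assert (Hp : 0 < Rpower t y) by apply exp_pos.
assert (Hx := exp_pos (- (a * t))).
assert (Hx1 : exp (- (a * t)) < 1) by (rewrite <- exp_0; apply exp_increasing; nra).
assert (Hlt : Rpower t y < eps).
{ replace eps with (Rpower (Rpower eps (/ y)) y).
  - apply exp_increasing, Rmult_lt_compat_l; [lra|]; apply ln_increasing; tauto.
  - rewrite Rpower_mult, Rinv_l, Rpower_1; lra. }
rewrite Rabs_pos_eq; nra.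
Qed.

Definition gamma_fun (x t : R) : R := Rpower t (x - 1) * exp (- t).

Lemma pos_continuous_gamma_fun (x : R) : pos_continuous (gamma_fun x).
Proof.
intros t Ht; apply (ex_derive_continuous (V := R_NormedModule)).
unfold gamma_fun, Rpower; auto_derive; lra.
Qed.

Lemma gamma_fun_pos (x t : R) : 0 < gamma_fun x t.
Proof. apply Rmult_lt_0_compat; apply exp_pos. Qed.

(* [t^(x-1) e^(-t)] is dominated by a multiple of the derivative of the
   bounded function [- 1 / (1 + t^x)]. *)
Lemma ex_is_int_gamma_fun (x : R) : 0 < x -> exists l, is_int (gamma_fun x) l.
Proof.
intros Hx.
(* [K] gives t^x <= K e^(t/2), hence (1 + t^x)^2 <= (1 + K)^2 e^t. [C] is the factor that turns this
   into [gamma_fun x t <= h t]. *)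
set (K := exp (x * ln (x / (1 / 2)) - x)).
set (C := (1 + K) * (1 + K) / x).
assert (HK : 0 < K) by apply exp_pos.
assert (HC : 0 < C) by (apply Rdiv_lt_0_compat; nra).
set (h := fun t => C * (x * Rpower t (x - 1) / (1 + Rpower t x) ^ 2)).
assert (Hh : pos_continuous h).
{ intros t Ht; apply (ex_derive_continuous (V := R_NormedModule)).
  assert (H := exp_pos (x * ln t)).
  unfold h, Rpower; auto_derive; repeat split; try lra; nra. }
assert (Hle : forall t, 0 < t -> gamma_fun x t <= h t).
{ intros t Ht; unfold gamma_fun, h.
  assert (H1 := exp_pos ((x - 1) * ln t)); fold (Rpower t (x - 1)) in H1.
  assert (H2 := exp_pos (x * ln t)); fold (Rpower t x) in H2.
  replace (C * (x * Rpower t (x - 1) / (1 + Rpower t x) ^ 2))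
    with (Rpower t (x - 1) * ((1 + K) * (1 + K) / (1 + Rpower t x) ^ 2))
    by (unfold C; field; lra).
  apply Rmult_le_compat_l; [lra|].
  apply (Rmult_le_reg_r ((1 + Rpower t x) ^ 2 * exp t)).
  { apply Rmult_lt_0_compat; [apply pow_lt; lra|apply exp_pos]. }
  replace (exp (- t) * ((1 + Rpower t x) ^ 2 * exp t))
    with ((1 + Rpower t x) ^ 2 * (exp (- t) * exp t)) by ring.
  rewrite <- exp_plus, Rplus_opp_l, exp_0, Rmult_1_r.
  replace ((1 + K) * (1 + K) / (1 + Rpower t x) ^ 2 * ((1 + Rpower t x) ^ 2 * exp t))
    with ((1 + K) * (1 + K) * exp t) by (field; lra).
  replace (exp t) with (exp (1 / 2 * t) * exp (1 / 2 * t))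
    by (rewrite <- exp_plus; f_equal; field).
  assert (H3 := Rpower_le_exp x (1 / 2) t Hx ltac:(lra) Ht); fold K in H3.
  assert (H4 : 1 < exp (1 / 2 * t)) by (rewrite <- exp_0 at 1; apply exp_increasing; lra).
  assert (H5 : 1 + Rpower t x <= (1 + K) * exp (1 / 2 * t)) by nra.
  replace ((1 + K) * (1 + K) * (exp (1 / 2 * t) * exp (1 / 2 * t)))
    with (((1 + K) * exp (1 / 2 * t)) ^ 2) by ring.
  apply pow_incr; lra. }
apply (ex_is_int_bounded (gamma_fun x) C).
- apply pos_continuous_gamma_fun.
- intros t Ht; left; apply gamma_fun_pos.
- intros a b Ha Hab; apply Rle_trans with (RInt h a b).
  { apply RInt_le; auto using ex_RInt_pos, pos_continuous_gamma_fun.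
    intros t Ht; apply Hle; lra. }
  rewrite (is_RInt_unique h a b (- C / (1 + Rpower b x) - - C / (1 + Rpower a x))).
  + assert (Hb := exp_pos (x * ln b)); fold (Rpower b x) in Hb.
    assert (Ha1 := exp_pos (x * ln a)); fold (Rpower a x) in Ha1.
    assert (H1 : 0 < C / (1 + Rpower b x)) by (apply Rdiv_lt_0_compat; lra).
    assert (H2 : C / (1 + Rpower a x) <= C).
    { apply (Rmult_le_reg_r (1 + Rpower a x)); [lra|].
      unfold Rdiv; rewrite Rmult_assoc, Rinv_l; nra. }
    unfold Rdiv in *; lra.
  + apply (is_RInt_derive (V := R_CompleteNormedModule)
      (fun t => - C / (1 + Rpower t x)) h a b);
    rewrite Rmin_left by lra; intros t Ht; [|apply Hh; lra].
    assert (H := exp_pos (x * ln t)).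
    unfold h; rewrite Rpower_minus_1 by lra; unfold Rpower.
    auto_derive; [lra|field; lra].
Qed.

Lemma is_int_Gamma (x : R) : 0 < x -> is_int (gamma_fun x) (Gamma x).
Proof.
intros Hx; destruct (ex_is_int_gamma_fun x Hx) as [l Hl].
unfold Gamma; fold (gamma_fun x).
now rewrite (is_RInt_gen_unique (gamma_fun x) l Hl).
Qed.

Lemma Gamma_pos (x : R) : 0 < x -> 0 < Gamma x.
Proof.
intros Hx; apply (is_int_gt_0 (gamma_fun x) _ 1 2); try lra.
- apply pos_continuous_gamma_fun.
- intros t _; left; apply gamma_fun_pos.
- now apply is_int_Gamma.
- intros t _; apply gamma_fun_pos.
Qed.

Lemma Gamma_plus_1 (x : R) : 0 < x -> Gamma (x + 1) = x * Gamma x.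
Proof.
intros Hx.
assert (H : is_int (fun t => x * gamma_fun x t - gamma_fun (x + 1) t) (0 - 0)).
{ apply (is_int_derive (fun t => Rpower t x * exp (- (1 * t)))).
  - intros t Ht; unfold gamma_fun.
    replace (x + 1 - 1) with x by ring; rewrite Rpower_minus_1 by lra.
    unfold Rpower; auto_derive; [lra|].
    replace (1 * t) with t by ring; field; lra.
  - apply pos_continuous_minus; [|apply pos_continuous_gamma_fun].
    intros t Ht; apply (ex_derive_continuous (V := R_NormedModule)).
    unfold gamma_fun, Rpower; auto_derive; lra.
  - apply filterlim_Rpower_exp_0; lra.
  - apply filterlim_Rpower_exp_p_infty; lra. }
assert (H' := is_int_minus _ _ _ _ (is_int_scal _ x _ (is_int_Gamma x Hx))
  (is_int_Gamma (x + 1) ltac:(lra))).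
generalize (is_int_unique _ _ _ H H'); lra.
Qed.

(** Take e^u >= 1 + u at u = (1-s) ln r and at u = -s ln r, multiply both by r^s, and average with
    weights s and 1-s: the logarithms cancel. *)
Lemma Rpower_Bernoulli (r s : R) : 0 < r -> 0 <= s <= 1 ->
  Rpower r s <= s * r + (1 - s).
Proof.
intros Hr Hs.
assert (Hp : 0 < Rpower r s) by apply exp_pos.
assert (H1 : Rpower r s * (1 + (1 - s) * ln r) <= r).
{ replace r with (Rpower r s * exp ((1 - s) * ln r)) at 3.
  - apply Rmult_le_compat_l; [lra|apply exp_ineq1_le].
  - unfold Rpower; rewrite <- exp_plus.
    replace (s * ln r + (1 - s) * ln r) with (ln r) by ring; now apply exp_ln. }
assert (H2 : Rpower r s * (1 + - (s * ln r)) <= 1).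
{ replace 1 with (Rpower r s * exp (- (s * ln r))) at 2.
  - apply Rmult_le_compat_l; [lra|apply exp_ineq1_le].
  - unfold Rpower; rewrite <- exp_plus, Rplus_opp_r; apply exp_0. }
assert (H3 := Rmult_le_compat_l s _ _ (proj1 Hs) H1).
assert (H4 := Rmult_le_compat_l (1 - s) _ _ ltac:(lra) H2).
lra.
Qed.

(** Wendel's inequality: integrate t^s <= x^s (s t/x + 1 - s) against the gamma integrand. The
    functional equation collapses the bracket to Gamma(x). *)
Lemma Gamma_plus_le (x s : R) : 0 < x -> 0 <= s <= 1 ->
  Gamma (x + s) <= Rpower x s * Gamma x.
Proof.
intros Hx Hs.
assert (H := is_int_scal _ (Rpower x s) _ (is_int_plus _ _ _ _
  (is_int_scal _ (s / x) _ (is_int_Gamma (x + 1) ltac:(lra)))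
  (is_int_scal _ (1 - s) _ (is_int_Gamma x Hx)))).
replace (Rpower x s * Gamma x)
  with (Rpower x s * (s / x * Gamma (x + 1) + (1 - s) * Gamma x))
  by (rewrite Gamma_plus_1 by lra; field; lra).
refine (is_int_le _ _ _ _ (pos_continuous_gamma_fun (x + s)) _ _
  (is_int_Gamma (x + s) ltac:(lra)) H).
- intros t Ht; apply (ex_derive_continuous (V := R_NormedModule)).
  unfold gamma_fun, Rpower; auto_derive; lra.
- intros t Ht; unfold gamma_fun.
  replace (x + s - 1) with (s + (x - 1)) by ring.
  replace (x + 1 - 1) with (1 + (x - 1)) by ring.
  rewrite !Rpower_plus, Rpower_1 by lra.
  assert (Hr : 0 < t / x) by (apply Rdiv_lt_0_compat; lra).
  assert (E : Rpower t s = Rpower x s * Rpower (t / x) s).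
  { rewrite Rpower_mult_distr by lra; f_equal; field; lra. }
  rewrite E.
  assert (HB := Rpower_Bernoulli (t / x) s Hr Hs).
  assert (Hq : 0 <= Rpower t (x - 1) * exp (- t)) by (left; apply gamma_fun_pos).
  assert (Hp : 0 <= Rpower x s) by (left; apply exp_pos).
  apply Rle_trans with (Rpower x s * (s * (t / x) + (1 - s)) * (Rpower t (x - 1) * exp (- t))).
  + rewrite Rmult_assoc.
    apply Rmult_le_compat_r; [exact Hq|]; now apply Rmult_le_compat_l.
  + right; field; lra.
Qed.

(** * Term-by-term differentiation of ln Gamma *)

Definition lnGamma (x : R) : R := ln (Gamma x).

Lemma lnGamma_plus_1 (x : R) : 0 < x -> lnGamma (x + 1) = ln x + lnGamma x.
Proof.
intros Hx; unfold lnGamma; rewrite Gamma_plus_1 by lra.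
apply ln_mult; [lra|now apply Gamma_pos].
Qed.

Lemma lnGamma_plus_le (x s : R) : 0 < x -> 0 <= s <= 1 ->
  lnGamma (x + s) <= s * ln x + lnGamma x.
Proof.
intros Hx Hs; unfold lnGamma.
assert (HG := Gamma_pos x Hx).
apply Rle_trans with (ln (Rpower x s * Gamma x)).
- apply ln_le; [apply Gamma_pos; lra|now apply Gamma_plus_le].
- unfold Rpower; rewrite ln_mult, ln_exp; auto using exp_pos; lra.
Qed.

(** The upper bound is applied to the remaining step of length 1-s from x+s to x+1. The result is
    weakened so that the error is the logarithmic difference handled by [is_lim_seq_ln_shift]. *)
Lemma lnGamma_plus_ge (x s : R) : 0 < x -> 0 <= s <= 1 ->
  s * ln x + lnGamma x - (ln (x + s) - ln x) <= lnGamma (x + s).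
Proof.
intros Hx Hs.
assert (H := lnGamma_plus_le (x + s) (1 - s) ltac:(lra) ltac:(lra)).
replace (x + s + (1 - s)) with (x + 1) in H by ring.
rewrite lnGamma_plus_1 in H by lra.
assert (Hl : ln x <= ln (x + s)) by (apply ln_le; lra).
nra.
Qed.

Lemma is_lim_seq_ln_shift (x : R) : 0 <= x ->
  is_lim_seq (fun n => ln (INR n + 1 + x) - ln (INR n + 1)) 0.
Proof.
intros Hx.
apply (is_lim_seq_le_le (fun _ => 0) _ (fun n => x * / (INR n + 1))).
- intros n; assert (Hn := pos_INR n); split.
  + assert (ln (INR n + 1) <= ln (INR n + 1 + x)) by (apply ln_le; lra); lra.
  + assert (Hp : 0 <= x * / (INR n + 1)).
    { apply Rmult_le_pos; [lra|left; apply Rinv_0_lt_compat; lra]. }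
    replace (INR n + 1 + x) with ((INR n + 1) * (1 + x * / (INR n + 1))) by (field; lra).
    rewrite ln_mult by lra.
    assert (H := exp_ineq1_le (ln (1 + x * / (INR n + 1)))).
    rewrite exp_ln in H by lra; lra.
- apply is_lim_seq_const.
- replace (Finite 0) with (Rbar_mult x 0) by (simpl; f_equal; ring).
  apply is_lim_seq_scal_l.
  apply (is_lim_seq_ext (fun n => / INR (S n))); [intros n; now rewrite S_INR|].
  apply (is_lim_seq_incr_1 (fun n => / INR n)).
  replace (Finite 0) with (Rbar_inv p_infty) by reflexivity.
  apply is_lim_seq_inv; [apply is_lim_seq_INR|discriminate].
Qed.

(** The Wendel bounds squeeze the fractional part of x. The functional equation then adds the
    integer part one unit at a time, each unit costing ln(n+1+y) - ln(n+1), which tends to 0. *)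
Lemma is_lim_seq_lnGamma_shift (x : R) : 0 <= x ->
  is_lim_seq (fun n => lnGamma (INR n + 1 + x) - lnGamma (INR n + 1)
                       - x * ln (INR n + 1)) 0.
Proof.
intros Hx; destruct (nfloor_ex x Hx) as [N HN].
replace x with (x - INR N + INR N) by ring.
assert (Hs : 0 <= x - INR N <= 1) by lra.
revert Hs; generalize (x - INR N); clear x Hx HN; intros s Hs.
induction N as [|N IH].
- simpl; rewrite Rplus_0_r.
  apply (is_lim_seq_le_le (fun n => - (ln (INR n + 1 + s) - ln (INR n + 1))) _ (fun _ => 0)).
  + intros n; assert (Hn := pos_INR n).
    generalize (lnGamma_plus_le (INR n + 1) s ltac:(lra) Hs)
      (lnGamma_plus_ge (INR n + 1) s ltac:(lra) Hs); lra.
  + replace (Finite 0) with (Rbar_opp 0) by (simpl; f_equal; ring).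
    apply -> is_lim_seq_opp; apply is_lim_seq_ln_shift; lra.
  + apply is_lim_seq_const.
- assert (HN := pos_INR N).
  apply (is_lim_seq_ext (fun n => (lnGamma (INR n + 1 + (s + INR N)) - lnGamma (INR n + 1)
      - (s + INR N) * ln (INR n + 1))
      + (ln (INR n + 1 + (s + INR N)) - ln (INR n + 1)))).
  + intros n; assert (Hn := pos_INR n); rewrite S_INR.
    replace (INR n + 1 + (s + (INR N + 1))) with (INR n + 1 + (s + INR N) + 1) by ring.
    rewrite (lnGamma_plus_1 (INR n + 1 + (s + INR N))) by lra; ring.
  + replace (Finite 0) with (Finite (0 + 0)) by (f_equal; ring).
    apply is_lim_seq_plus'; [exact IH|apply is_lim_seq_ln_shift; lra].
Qed.

Lemma lnGamma_plus_INR (x : R) (n : nat) : 0 < x ->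
  lnGamma (INR n + 1 + x) = lnGamma x + sum_f_R0 (fun j => ln (x + INR j)) n.
Proof.
intros Hx; induction n as [|n IH].
- simpl; replace (0 + 1 + x) with (x + 1) by ring.
  rewrite lnGamma_plus_1, Rplus_0_r by lra; ring.
- assert (Hn := pos_INR n); rewrite tech5, <- Rplus_assoc, <- IH, S_INR.
  replace (INR n + 1 + 1 + x) with (INR n + 1 + x + 1) by ring.
  rewrite lnGamma_plus_1 by lra.
  replace (x + (INR n + 1)) with (INR n + 1 + x) by ring; ring.
Qed.

(** Gauss's limit formula in logarithmic form. The term [lnGamma (INR n + 1)] need not be evaluated
    as ln n!, since it is constant in x and vanishes on differentiation. *)
Lemma is_lim_seq_lnGamma (x : R) : 0 < x ->
  is_lim_seq (fun n => lnGamma (INR n + 1) + x * ln (INR n + 1)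
                       - sum_f_R0 (fun j => ln (x + INR j)) n) (lnGamma x).
Proof.
intros Hx.
assert (H := is_lim_seq_minus' _ _ _ _ (is_lim_seq_const (lnGamma x))
  (is_lim_seq_lnGamma_shift x ltac:(lra))).
rewrite Rminus_0_r in H; revert H; apply is_lim_seq_ext; intros n.
rewrite lnGamma_plus_INR by lra; ring.
Qed.

(** Two uses of the mean value theorem; they lose only the factor 1/2 of Taylor's remainder. *)
Lemma taylor_1_le (f f1 f2 : R -> R) (a M x y : R) :
  (forall t, a < t -> is_derive f t (f1 t)) ->
  (forall t, a < t -> is_derive f1 t (f2 t)) ->
  a < x -> a < y ->
  (forall t, Rmin x y <= t -> Rabs (f2 t) <= M) ->
  Rabs (f y - f x - f1 x * (y - x)) <= M * (y - x) ^ 2.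
Proof.
intros H1 H2 Hx Hy HM.
assert (Hm : a < Rmin x y) by now apply Rmin_glb_lt.
assert (C : forall g dg : R -> R, (forall t, a < t -> is_derive g t (dg t)) ->
  forall t, a < t -> continuity_pt g t).
{ intros g dg Hg t Ht; apply derivable_continuous_pt.
  exists (dg t); apply is_derive_Reals; auto. }
destruct (MVT_gen f x y f1) as [c [Hc Ec]].
- intros t Ht; apply H1; lra.
- intros t Ht; apply (C f f1); auto; lra.
- destruct (MVT_gen f1 x c f2) as [d [Hd Ed]].
  + intros t Ht; apply H2.
    apply Rlt_trans with (Rmin x c); [apply Rmin_glb_lt|]; lra.
  + intros t Ht; apply (C f1 f2); auto.
    apply Rlt_le_trans with (Rmin x c); [apply Rmin_glb_lt|]; lra.
  + rewrite Ec.
    replace (f1 c * (y - x) - f1 x * (y - x)) with (f2 d * ((c - x) * (y - x)))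
      by (rewrite <- Rmult_assoc, <- Ed; ring).
    assert (Hd1 : Rmin x y <= d).
    { apply Rle_trans with (Rmin x c); [|lra].
      apply Rmin_glb; [apply Rmin_l|lra]. }
    rewrite Rabs_mult.
    apply Rmult_le_compat; auto using Rabs_pos.
    unfold Rmin, Rmax in Hc; destruct (Rle_dec x y); apply Rabs_le; nra.
Qed.

(* Only pointwise convergence is assumed: the bound on [f2] makes the
   difference quotients of the [f n] uniformly close to [f1 n]. *)
Lemma is_derive_lim_seq (f f1 f2 : nat -> R -> R) (F : R -> R) (a : R) :
  (forall n t, a < t -> is_derive (f n) t (f1 n t)) ->
  (forall n t, a < t -> is_derive (f1 n) t (f2 n t)) ->
  (forall x, a < x -> exists M, forall n t, x <= t -> Rabs (f2 n t) <= M) ->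
  (forall x, a < x -> is_lim_seq (fun n => f n x) (F x)) ->
  forall x, a < x ->
  exists l : R, is_lim_seq (fun n => f1 n x) l /\ is_derive F x l.
Proof.
intros H1 H2 HM HF x Hx.
(* The midpoint leaves room for increments to the left of x while one bound [M] serves from [x0]
   on. *)
set (x0 := (a + x) / 2).
destruct (HM x0 ltac:(unfold x0; lra)) as [M HM0].
assert (HMp : 0 <= M).
{ apply Rle_trans with (Rabs (f2 O x)); [apply Rabs_pos|apply HM0; unfold x0; lra]. }
assert (HT : forall n y, x0 <= y ->
  Rabs (f n y - f n x - f1 n x * (y - x)) <= M * (y - x) ^ 2).
{ intros n y Hy; apply (taylor_1_le (f n) (f1 n) (f2 n) a); auto.
  - unfold x0 in Hy; lra.
  - intros t Ht; apply HM0; apply Rle_trans with (2 := Ht).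
    apply Rmin_glb; [unfold x0; lra|exact Hy]. }
assert (Hc : ex_finite_lim_seq (fun n => f1 n x)).
{ apply ex_lim_seq_cauchy_corr; intros eps.
  assert (He := cond_pos eps).
  (* With this step the two Taylor errors total 2 M h^2 < eps h / 2. Increments that are Cauchy to
     within eps h / 2 then make the derivatives Cauchy to within eps. The [+ 1] covers M = 0. *)
  set (h := eps / (4 * (M + 1))).
  assert (Hh : 0 < h) by (apply Rdiv_lt_0_compat; lra).
  assert (HhM : 4 * (M * h) < eps).
  { replace (pos eps) with (4 * ((M + 1) * h)) by (unfold h; field; lra); nra. }
  assert (Hq : is_lim_seq (fun n => f n (x + h) - f n x) (F (x + h) - F x)).
  { apply is_lim_seq_minus'; apply HF; lra. }
  assert (Hq' : ex_lim_seq_cauchy (fun n => f n (x + h) - f n x)).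
  { apply ex_lim_seq_cauchy_corr; eexists; exact Hq. }
  assert (Heh : 0 < eps * h / 2) by (apply Rdiv_lt_0_compat; nra).
  destruct (Hq' (mkposreal _ Heh)) as [N HN]; simpl in HN.
  exists N; intros n m Hn Hm; specialize (HN n m Hn Hm).
  assert (Tn := HT n (x + h) ltac:(unfold x0; lra)).
  assert (Tm := HT m (x + h) ltac:(unfold x0; lra)).
  replace (x + h - x) with h in Tn, Tm by ring.
  apply Rabs_def2 in HN.
  apply Rabs_le_between in Tn; apply Rabs_le_between in Tm.
  assert (Hb : Rabs ((f1 n x - f1 m x) * h) < eps * h).
  { replace (M * h ^ 2) with (M * h * h) in Tn, Tm by ring.
    assert (4 * (M * h) * h < eps * h) by (apply Rmult_lt_compat_r; lra).
    apply Rabs_def1; lra. }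
  rewrite Rabs_mult, (Rabs_pos_eq h) in Hb by lra.
  apply Rmult_lt_reg_r in Hb; auto. }
destruct Hc as [l Hl]; exists l; split; [exact Hl|].
(* The quadratic error bound is uniform in n, so it survives the limit and yields the derivative of
   [F] at x. *)
assert (HTl : forall y, x0 <= y -> Rabs (F y - F x - l * (y - x)) <= M * (y - x) ^ 2).
{ intros y Hy.
  apply (is_lim_seq_le (fun n => Rabs (f n y - f n x - f1 n x * (y - x)))
    (fun _ => M * (y - x) ^ 2) (Rabs (F y - F x - l * (y - x))) (M * (y - x) ^ 2)).
  - intros n; now apply HT.
  - apply (is_lim_seq_abs _ (Finite (F y - F x - l * (y - x)))).
    apply is_lim_seq_minus'.
    + apply is_lim_seq_minus'; apply HF; unfold x0 in Hy; lra.
    + apply (is_lim_seq_scal_r _ (y - x) (Finite l)); exact Hl.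
  - apply is_lim_seq_const. }
apply is_derive_Reals; intros eps He.
assert (Hd : 0 < Rmin (x - x0) (eps / (M + 1))).
{ apply Rmin_glb_lt; [unfold x0; lra|apply Rdiv_lt_0_compat; lra]. }
exists (mkposreal _ Hd); simpl; intros h Hh0 Hh.
assert (Hh1 := Rlt_le_trans _ _ _ Hh (Rmin_l _ _)).
assert (Hh2 := Rlt_le_trans _ _ _ Hh (Rmin_r _ _)).
apply Rabs_def2 in Hh1.
specialize (HTl (x + h) ltac:(lra)); replace (x + h - x) with h in HTl by ring.
assert (Ha : 0 < Rabs h) by now apply Rabs_pos_lt.
apply (Rmult_lt_reg_r (Rabs h)); [exact Ha|].
rewrite <- Rabs_mult.
replace (((F (x + h) - F x) / h - l) * h) with (F (x + h) - F x - l * h) by (field; auto).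
apply Rle_lt_trans with (1 := HTl).
rewrite <- (pow2_abs h).
apply Rmult_lt_compat_r with (r := M + 1) in Hh2; [|lra].
replace (eps / (M + 1) * (M + 1)) with eps in Hh2 by (field; lra).
nra.
Qed.

(** * The integral of t^m e^(-xt) t/(e^t - 1) *)

Definition pow_exp (m : nat) (a t : R) : R := t ^ m * exp (- (a * t)).

Lemma pos_continuous_pow_exp (m : nat) (a : R) : pos_continuous (pow_exp m a).
Proof.
intros t Ht; apply (ex_derive_continuous (V := R_NormedModule)).
unfold pow_exp; auto_derive; auto.
Qed.

(** Induction by parts: the derivative of t^(m+1) e^(-at) integrates to 0, both boundary values
    being 0. *)
Lemma is_int_pow_exp (m : nat) (a : R) : 0 < a ->
  is_int (pow_exp m a) (INR (fact m) / a ^ S m).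
Proof.
intros Ha.
induction m as [|m IH].
- replace (INR (fact 0) / a ^ 1) with (0 - - / a) by (simpl; field; lra).
  apply (is_int_derive (fun t => - / a * exp (- (a * t)))).
  + intros t Ht; unfold pow_exp; auto_derive; [auto|simpl; field; lra].
  + apply pos_continuous_pow_exp.
  + assert (Hc : continuous (fun t => - / a * exp (- (a * t))) 0).
    { apply (ex_derive_continuous (V := R_NormedModule)); auto_derive; auto. }
    unfold continuous in Hc; rewrite Rmult_0_r, Ropp_0, exp_0, Rmult_1_r in Hc.
    intros P HP; apply (filter_le_within (F := locally 0)); exact (Hc P HP).
  + apply filterlim_p_infty_inv with (/ a * / a); intros t Ht.
    assert (He := exp_pos (- (a * t))).
    assert (Hi : 0 < / a) by now apply Rinv_0_lt_compat.
    rewrite Rminus_0_r, Rabs_mult, Rabs_Ropp, !Rabs_pos_eq by lra.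
    unfold Rdiv; rewrite Rmult_assoc; apply Rmult_le_compat_l; [lra|].
    apply (Rmult_le_reg_r (exp (a * t) * (a * t))).
    { apply Rmult_lt_0_compat; [apply exp_pos|nra]. }
    rewrite <- Rmult_assoc, <- exp_plus, Rplus_opp_l, exp_0.
    replace (/ a * / t * (exp (a * t) * (a * t))) with (exp (a * t)) by (field; lra).
    generalize (exp_ineq1_le (a * t)); lra.
- assert (Hm := pos_INR m).
  assert (HS : INR (S m) = INR m + 1) by apply S_INR.
  assert (H : is_int (fun t => INR (S m) * pow_exp m a t - a * pow_exp (S m) a t) (0 - 0)).
  (* The boundary limits are available for real exponents, so the primitive is written with
     [Rpower]. *)
  { assert (E : forall t, 0 < t ->
      Rpower t (INR (S m)) * exp (- (a * t)) = pow_exp (S m) a t).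
    { intros t Ht; unfold pow_exp; now rewrite Rpower_pow. }
    assert (Hc : pos_continuous (fun t => INR (S m) * pow_exp m a t - a * pow_exp (S m) a t)).
    { apply pos_continuous_minus; intros t Ht;
      apply (ex_derive_continuous (V := R_NormedModule));
      unfold pow_exp; auto_derive; auto. }
    apply (is_int_derive (fun t => Rpower t (INR (S m)) * exp (- (a * t)))); [|exact Hc| |].
    - intros t Ht.
      apply (is_derive_ext_loc (pow_exp (S m) a)).
      + apply (locally_interval _ t 0 p_infty); simpl; auto.
        intros y Hy _; now rewrite E.
      + unfold pow_exp; auto_derive; [auto|].
        change (match m with O => 1 | S _ => INR m + 1 end) with (INR (S m)).
        simpl (t ^ S m); ring.
    - apply filterlim_Rpower_exp_0; lra.
    - apply filterlim_Rpower_exp_p_infty; lra. }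
  assert (H' := is_int_scal _ (/ a) _ (is_int_minus _ _ _ _ (is_int_scal _ (INR (S m)) _ IH) H)).
  replace (INR (fact (S m)) / a ^ S (S m))
    with (/ a * (INR (S m) * (INR (fact m) / a ^ S m) - (0 - 0))).
  + revert H'; apply is_int_ext; intros t Ht; field; lra.
  + rewrite fact_simpl, mult_INR; simpl (a ^ S (S m)); simpl (a ^ S m); field.
    split; [apply pow_nonzero; lra|lra].
Qed.

Definition bernoulli_gf (t : R) : R := t / (exp t - 1).

Lemma exp_minus_1_pos (t : R) : 0 < t -> 0 < exp t - 1.
Proof. intros Ht; generalize (exp_ineq1 t); lra. Qed.

Lemma bernoulli_gf_pos (t : R) : 0 < t -> 0 < bernoulli_gf t.
Proof. intros Ht; apply Rdiv_lt_0_compat; [lra|now apply exp_minus_1_pos]. Qed.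

(** * Elementary bounds on t/(e^t - 1) *)

Lemma increasing_derive_pos (f df : R -> R) (a b : R) : a < b ->
  (forall t, a <= t <= b -> is_derive f t (df t)) ->
  (forall t, a < t < b -> 0 < df t) -> f a < f b.
Proof.
intros Hab Hd Hp.
destruct (MVT_cor2 f df a b Hab) as [c [Ec Hc]].
{ intros t Ht; apply is_derive_Reals; auto. }
specialize (Hp c Hc); nra.
Qed.

(** Equivalent to t/2 < sinh(t/2). It gives both the upper bound on [bernoulli_gf] and the
    monotonicity of [rate_slope]. *)
Lemma mul_exp_half_lt (t : R) : 0 < t -> t * exp (t / 2) < exp t - 1.
Proof.
intros Ht.
assert (H := increasing_derive_pos (fun u => exp u - 1 - u * exp (u / 2))
  (fun u => exp (u / 2) * (exp (u / 2) - 1 - u / 2)) 0 t Ht).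
simpl in H; rewrite exp_0 in H.
enough (1 - 1 - 0 * exp (0 / 2) < exp t - 1 - t * exp (t / 2)) by lra.
apply H.
- intros u _; auto_derive; auto.
  replace (exp u) with (exp (u / 2) * exp (u / 2))
    by (rewrite <- exp_plus; f_equal; field).
  unfold Rdiv; ring.
- intros u Hu; apply Rmult_lt_0_compat; [apply exp_pos|].
  generalize (exp_ineq1 (u / 2)); lra.
Qed.

Lemma bernoulli_gf_lt (t : R) : 0 < t -> bernoulli_gf t < exp (- (t / 2)).
Proof.
intros Ht; assert (H := mul_exp_half_lt t Ht).
assert (Hp := exp_minus_1_pos t Ht).
apply (Rmult_lt_reg_r (exp (t / 2) * (exp t - 1))).
{ apply Rmult_lt_0_compat; [apply exp_pos|lra]. }
replace (exp (- (t / 2)) * (exp (t / 2) * (exp t - 1)))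
  with (exp (- (t / 2)) * exp (t / 2) * (exp t - 1)) by ring.
rewrite <- exp_plus, Rplus_opp_l, exp_0.
unfold bernoulli_gf; replace (t / (exp t - 1) * (exp (t / 2) * (exp t - 1)))
  with (t * exp (t / 2)) by (field; lra); lra.
Qed.

(** The bound is the start of the expansion at 0. After clearing the denominator, the difference
    vanishes at 0 and has derivative (1/2) e^u (e^(-u) - 1 + u) > 0. *)
Lemma bernoulli_gf_ge (t : R) : 0 < t -> 1 - t / 2 <= bernoulli_gf t.
Proof.
intros Ht; assert (Hp := exp_minus_1_pos t Ht).
assert (H : 0 < t - (1 - t / 2) * (exp t - 1)).
{ replace 0 with (0 - (1 - 0 / 2) * (exp 0 - 1)) at 1 by (rewrite exp_0; field).
  apply (increasing_derive_pos (fun u => u - (1 - u / 2) * (exp u - 1))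
    (fun u => / 2 * exp u * (exp (- u) - 1 + u)) 0 t Ht).
  - intros u _; auto_derive; auto.
    replace (/ 2 * exp u * (exp (- u) - 1 + u))
      with (/ 2 * (exp u * exp (- u)) + / 2 * exp u * (u - 1)) by ring.
    rewrite <- exp_plus, Rplus_opp_r, exp_0; field.
  - intros u Hu; apply Rmult_lt_0_compat; [generalize (exp_pos u); lra|].
    generalize (exp_ineq1 (- u)); lra. }
apply (Rmult_le_reg_r (exp t - 1)); [lra|].
unfold bernoulli_gf; replace (t / (exp t - 1) * (exp t - 1)) with t by (field; lra); lra.
Qed.

Definition polygamma_fun (m : nat) (x t : R) : R := pow_exp m x t * bernoulli_gf t.

Lemma pos_continuous_polygamma_fun (m : nat) (x : R) :
  pos_continuous (polygamma_fun m x).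
Proof.
intros t Ht; assert (Hp := exp_minus_1_pos t Ht).
apply (ex_derive_continuous (V := R_NormedModule)).
unfold polygamma_fun, pow_exp, bernoulli_gf; auto_derive; repeat split; lra.
Qed.

Lemma pow_exp_pos (m : nat) (a t : R) : 0 < t -> 0 < pow_exp m a t.
Proof. intros Ht; apply Rmult_lt_0_compat; [now apply pow_lt|apply exp_pos]. Qed.

Lemma polygamma_fun_pos (m : nat) (x t : R) : 0 < t -> 0 < polygamma_fun m x t.
Proof.
intros Ht; apply Rmult_lt_0_compat; [now apply pow_exp_pos|now apply bernoulli_gf_pos].
Qed.

Lemma pow_exp_shift (m : nat) (a b t : R) :
  pow_exp m (a + b) t = pow_exp m a t * exp (- (b * t)).
Proof.
unfold pow_exp; rewrite Rmult_assoc, <- exp_plus; do 2 f_equal; ring.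
Qed.

Lemma polygamma_fun_lt (m : nat) (x t : R) : 0 < t ->
  polygamma_fun m x t < pow_exp m (x + 1 / 2) t.
Proof.
intros Ht; rewrite pow_exp_shift; apply Rmult_lt_compat_l; [now apply pow_exp_pos|].
replace (1 / 2 * t) with (t / 2) by field; now apply bernoulli_gf_lt.
Qed.

(** The factor e^(-t/2) buys convergence slightly below x = 0. This makes 0 an interior point, as
    the derivatives of psi at 1 require. *)
Lemma ex_is_int_polygamma_fun (m : nat) (x : R) : - (1 / 2) < x ->
  exists l, is_int (polygamma_fun m x) l.
Proof.
intros Hx; apply (ex_is_int_dominated _ (pow_exp m (x + 1 / 2))
  (INR (fact m) / (x + 1 / 2) ^ S m)).
- apply pos_continuous_polygamma_fun.
- apply pos_continuous_pow_exp.
- intros t Ht; split; left; [now apply polygamma_fun_pos|now apply polygamma_fun_lt].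
- apply is_int_pow_exp; lra.
Qed.

(** The first n + 1 terms of the Hurwitz zeta series at (p, x). *)
Definition recip_sum (p n : nat) (x : R) : R :=
  sum_f_R0 (fun j => / (x + INR j) ^ p) n.

(** Moving x to x+1 multiplies the integrand by e^(-t), and (1 - e^(-t)) g(t) = t e^(-t) for g(t) =
    t/(e^t - 1). What is lost is therefore an integral of t^(m+1) e^(-(x+1)t). *)
Lemma is_int_polygamma_fun_step (m : nat) (x l : R) : - 1 < x ->
  is_int (polygamma_fun m x) l ->
  is_int (polygamma_fun m (x + 1)) (l - INR (fact (S m)) * / (x + 1) ^ S (S m)).
Proof.
intros Hx Hl.
assert (H := is_int_minus _ _ _ _ Hl (is_int_pow_exp (S m) (x + 1) ltac:(lra))).
revert H; apply is_int_ext; intros t Ht.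
assert (Hp := exp_minus_1_pos t Ht).
unfold polygamma_fun; rewrite !pow_exp_shift; unfold pow_exp, bernoulli_gf.
rewrite Rmult_1_l, (exp_Ropp t); simpl (t ^ S m); field; lra.
Qed.

Lemma is_int_polygamma_fun_iter (m n : nat) (x l : R) : - 1 < x ->
  is_int (polygamma_fun m x) l ->
  is_int (polygamma_fun m (x + 1 + INR n))
    (l - INR (fact (S m)) * recip_sum (S (S m)) n (x + 1)).
Proof.
intros Hx Hl; induction n as [|n IH].
- unfold recip_sum; simpl sum_f_R0; simpl INR; rewrite Rplus_0_r.
  now apply is_int_polygamma_fun_step.
- assert (Hn := pos_INR n).
  apply is_int_polygamma_fun_step in IH; [|lra].
  unfold recip_sum in *; rewrite tech5, S_INR.
  replace (x + 1 + (INR n + 1)) with (x + 1 + INR n + 1) by ring.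
  replace (l - _) with
   (l - INR (fact (S m)) * sum_f_R0 (fun j => / (x + 1 + INR j) ^ S (S m)) n -
       INR (fact (S m)) * / (x + 1 + INR n + 1) ^ S (S m)) by ring.
  exact IH.
Qed.

(** The remainder is the same integral at x+1+n. It lies between 0 and m!/(n+x+1)^(m+1), because
    [bernoulli_gf] is at most 1. *)
Lemma is_lim_seq_recip_sum (m : nat) (x l : R) : - (1 / 2) < x ->
  is_int (polygamma_fun m x) l ->
  is_lim_seq (fun n => INR (fact (S m)) * recip_sum (S (S m)) n (x + 1)) l.
Proof.
intros Hx Hl.
assert (Hb : forall n, 0 <= l - INR (fact (S m)) * recip_sum (S (S m)) n (x + 1)
  <= INR (fact m) * (/ (INR n + (x + 1))) ^ S m).
{ intros n; assert (Hn := pos_INR n).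
  assert (H := is_int_polygamma_fun_iter m n x l ltac:(lra) Hl); split.
  - apply (is_int_ge_0 (polygamma_fun m (x + 1 + INR n))); auto.
    + apply pos_continuous_polygamma_fun.
    + intros t Ht; left; now apply polygamma_fun_pos.
  - assert (H1 := is_int_pow_exp m (INR n + (x + 1)) ltac:(lra)).
    rewrite pow_inv; refine (is_int_le _ _ _ _ _ _ _ H H1).
    + apply pos_continuous_polygamma_fun.
    + apply pos_continuous_pow_exp.
    + intros t Ht; unfold polygamma_fun.
      replace (x + 1 + INR n) with (INR n + (x + 1)) by ring.
      rewrite <- (Rmult_1_r (pow_exp m (INR n + (x + 1)) t)) at 2.
      apply Rmult_le_compat_l; [left; now apply pow_exp_pos|].
      apply Rle_trans with (exp (- (t / 2))); [left; now apply bernoulli_gf_lt|].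
      rewrite <- exp_0; left; apply exp_increasing; lra. }
apply (is_lim_seq_le_le (fun n => l - INR (fact m) * (/ (INR n + (x + 1))) ^ S m) _ (fun _ => l)).
- intros n; specialize (Hb n); lra.
- replace (Finite l) with (Finite (l - INR (fact m) * 0 ^ S m)) by (f_equal; simpl; ring).
  apply is_lim_seq_minus'; [apply is_lim_seq_const|].
  apply (is_lim_seq_continuous (fun u => INR (fact m) * u ^ S m)
    (fun n => / (INR n + (x + 1))) 0).
  + apply continuity_pt_filterlim.
    apply (ex_derive_continuous (V := R_NormedModule)
      (fun u => INR (fact m) * u ^ S m) 0); auto_derive; auto.
  + replace (Finite 0) with (Rbar_inv p_infty) by reflexivity.
    apply is_lim_seq_inv; [|discriminate].
    apply is_lim_seq_plus with p_infty (x + 1);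
      [apply is_lim_seq_INR|apply is_lim_seq_const|reflexivity].
- apply is_lim_seq_const.
Qed.

(** * Polygamma functions and the sharp bounds *)

Lemma is_derive_sum_f_R0 (f df : nat -> R -> R) (x : R) (n : nat) :
  (forall j, is_derive (f j) x (df j x)) ->
  is_derive (fun y => sum_f_R0 (fun j => f j y) n) x (sum_f_R0 (fun j => df j x) n).
Proof.
intros H; induction n as [|n IH]; simpl; [apply H|].
apply (is_derive_plus (V := R_NormedModule) _ _ x _ _ IH (H (S n))).
Qed.

Lemma is_derive_recip_sum (p n : nat) (x : R) : 0 < x ->
  is_derive (recip_sum p n) x (- INR p * recip_sum (S p) n x).
Proof.
intros Hx; unfold recip_sum; rewrite scal_sum.
apply (is_derive_sum_f_R0 (fun j y => / (y + INR j) ^ p)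
  (fun j y => / (y + INR j) ^ S p * - INR p)).
intros j; assert (Hj := pos_INR j).
assert (Hp : forall q, (x + INR j) ^ q <> 0) by (intros q; apply pow_nonzero; lra).
auto_derive; [apply Hp|].
destruct p as [|p]; [simpl; field; lra|].
change (Init.Nat.pred (S p)) with p.
simpl (_ ^ S (S p)); simpl (_ ^ S p); field; split; [apply Hp|lra].
Qed.

(* The [k]-th derivative of the [n]-th approximation to [psi]; the term
   [ln (n + 1)] survives only for [k = 0]. *)
Definition psi_approx (k n : nat) (x : R) : R :=
  match k with O => ln (INR n + 1) | S _ => 0 end
  + (-1) ^ S k * INR (fact k) * recip_sum (S k) n x.

Lemma is_derive_psi_approx (k n : nat) (x : R) : 0 < x ->
  is_derive (psi_approx k n) x (psi_approx (S k) n x).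
Proof.
intros Hx; unfold psi_approx.
assert (H := is_derive_recip_sum (S k) n x Hx).
set (c := match k with O => ln (INR n + 1) | S _ => 0 end).
set (d := (-1) ^ S k * INR (fact k)).
replace (0 + (-1) ^ S (S k) * INR (fact (S k)) * recip_sum (S (S k)) n x)
  with (0 + d * (- INR (S k) * recip_sum (S (S k)) n x)).
- apply (is_derive_plus (V := R_NormedModule) (fun _ => c)).
  + apply (is_derive_const (V := R_NormedModule)).
  + apply is_derive_scal; exact H.
- unfold d; rewrite fact_simpl, mult_INR; simpl ((-1) ^ S (S k)); simpl ((-1) ^ S k); ring.
Qed.

Lemma recip_sum_pos (p n : nat) (x : R) : 0 < x -> 0 < recip_sum p n x.
Proof.
intros Hx; unfold recip_sum; induction n as [|n IH]; simpl.
- apply Rinv_0_lt_compat, pow_lt; lra.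
- apply Rplus_lt_0_compat; [exact IH|].
  change (match n with O => 1 | S _ => INR n + 1 end) with (INR (S n)).
  apply Rinv_0_lt_compat, pow_lt; generalize (pos_INR (S n)); lra.
Qed.

Lemma recip_sum_decr (p n : nat) (x y : R) : 0 < x -> x <= y ->
  recip_sum p n y <= recip_sum p n x.
Proof.
intros Hx Hy; apply sum_Rle; intros j _; assert (Hj := pos_INR j).
apply Rinv_le_contravar; [apply pow_lt; lra|apply pow_incr; lra].
Qed.

Lemma Rabs_psi_approx (m n : nat) (x : R) : 0 < x ->
  Rabs (psi_approx (S m) n x) = INR (fact (S m)) * recip_sum (S (S m)) n x.
Proof.
intros Hx; unfold psi_approx; rewrite Rplus_0_l, !Rabs_mult, pow_1_abs.
rewrite !Rabs_pos_eq; [ring|left; now apply recip_sum_pos|apply pos_INR].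
Qed.

(** By monotonicity it suffices to bound the sums at x. There the full integral is a bound for every
    n, since the remainder integral is nonnegative. *)
Lemma psi_approx_bounded (m : nat) (x : R) : 1 / 2 < x ->
  exists M, forall n t, x <= t -> Rabs (psi_approx (S m) n t) <= M.
Proof.
intros Hx; destruct (ex_is_int_polygamma_fun m (x - 1)) as [l Hl]; [lra|].
exists l; intros n t Ht; rewrite Rabs_psi_approx by lra.
apply Rle_trans with (INR (fact (S m)) * recip_sum (S (S m)) n x).
{ apply Rmult_le_compat_l; [apply pos_INR|apply recip_sum_decr; lra]. }
assert (H := is_int_polygamma_fun_iter m n (x - 1) l ltac:(lra) Hl).
replace (x - 1 + 1) with x in H by ring.
enough (0 <= l - INR (fact (S m)) * recip_sum (S (S m)) n x) by lra.
revert H; apply is_int_ge_0; [apply pos_continuous_polygamma_fun|].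
intros u Hu; left; now apply polygamma_fun_pos.
Qed.

(** Differentiability of [Gamma] is obtained here, not assumed: near x it is the exponential of
    [lnGamma]. *)
Lemma psi_of_lnGamma (x l : R) : 0 < x -> is_derive lnGamma x l -> psi x = l.
Proof.
intros Hx Hl.
assert (H : is_derive Gamma x (l * exp (lnGamma x))).
{ apply (is_derive_ext_loc (fun y => exp (lnGamma y))).
  - apply (locally_interval _ x 0 p_infty); simpl; auto.
    intros y Hy _; unfold lnGamma; apply exp_ln; now apply Gamma_pos.
  - apply (is_derive_comp exp lnGamma); [|exact Hl]; apply is_derive_Reals, derivable_pt_lim_exp. }
assert (HG := Gamma_pos x Hx).
unfold psi; rewrite (is_derive_unique _ _ _ H); unfold lnGamma.
rewrite exp_ln by auto; field; lra.
Qed.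

Lemma is_lim_seq_psi_approx_0 (x : R) : 1 / 2 < x ->
  is_lim_seq (fun n => psi_approx 0 n x) (psi x).
Proof.
intros Hx.
destruct (is_derive_lim_seq
  (fun n x => lnGamma (INR n + 1) + x * ln (INR n + 1)
              - sum_f_R0 (fun j => ln (x + INR j)) n)
  (psi_approx 0) (psi_approx 1) lnGamma (1 / 2)) with x as [l [Hl Hd]]; auto.
- intros n t Ht; assert (Hn := pos_INR n).
  replace (psi_approx 0 n t) with
    (0 + ln (INR n + 1) - sum_f_R0 (fun j => / (t + INR j)) n).
  + apply (is_derive_minus (V := R_NormedModule)
      (fun t => lnGamma (INR n + 1) + t * ln (INR n + 1))).
    * auto_derive; [auto|ring].
    * apply (is_derive_sum_f_R0 (fun j y => ln (y + INR j)) (fun j y => / (y + INR j))).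
      intros j; assert (Hj := pos_INR j); auto_derive; [lra|field; lra].
  + unfold psi_approx, recip_sum.
    rewrite (sum_eq (fun j => / (t + INR j)) (fun j => / (t + INR j) ^ 1));
      [simpl; ring|intros j _; now rewrite pow_1].
- intros n t Ht; apply is_derive_psi_approx; lra.
- apply psi_approx_bounded.
- intros t Ht; apply is_lim_seq_lnGamma; lra.
- now rewrite (psi_of_lnGamma x l ltac:(lra) Hd).
Qed.

Lemma is_lim_seq_psi_approx (k : nat) (x : R) : 1 / 2 < x ->
  is_lim_seq (fun n => psi_approx k n x) (Derive_n psi k x).
Proof.
revert x; induction k as [|k IH]; intros x Hx.
{ now apply is_lim_seq_psi_approx_0. }
destruct (is_derive_lim_seq (psi_approx k) (psi_approx (S k)) (psi_approx (S (S k)))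
  (Derive_n psi k) (1 / 2)) with x as [l [Hl Hd]]; auto.
- intros n t Ht; apply is_derive_psi_approx; lra.
- intros n t Ht; apply is_derive_psi_approx; lra.
- apply psi_approx_bounded.
- simpl Derive_n; now rewrite (is_derive_unique _ _ _ Hd).
Qed.

(** The integral and the absolute polygamma value are limits of one and the same sequence of
    sums. *)
Lemma is_int_Rabs_polygamma (m : nat) (x : R) : - (1 / 2) < x ->
  is_int (polygamma_fun m x) (Rabs (polygamma (S m) (x + 1))).
Proof.
intros Hx; destruct (ex_is_int_polygamma_fun m x Hx) as [l Hl].
assert (H1 := is_lim_seq_recip_sum m x l Hx Hl).
assert (H2 := is_lim_seq_psi_approx (S m) (x + 1) ltac:(lra)).
apply is_lim_seq_abs in H2.
apply (is_lim_seq_ext _ (fun n => INR (fact (S m)) * recip_sum (S (S m)) n (x + 1))) in H2;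
  [|intros n; apply Rabs_psi_approx; lra].
apply is_lim_seq_unique in H1; apply is_lim_seq_unique in H2.
rewrite H1 in H2; simpl in H2; injection H2 as H2.
unfold polygamma; simpl Derive_n; now rewrite <- H2.
Qed.

(** The exponent r(t) with t/(e^t - 1) = e^(-r(t) t): comparing that function with e^(-ct) amounts
    to comparing r(t) with c. *)
Definition bernoulli_rate (t : R) : R := - ln (bernoulli_gf t) / t.

Lemma bernoulli_gf_rate (t : R) : 0 < t ->
  bernoulli_gf t = exp (- (bernoulli_rate t * t)).
Proof.
intros Ht; unfold bernoulli_rate.
replace (- (- ln (bernoulli_gf t) / t * t)) with (ln (bernoulli_gf t)) by (field; lra).
now rewrite exp_ln by now apply bernoulli_gf_pos.
Qed.

(* [t ^ 2] times the derivative of [bernoulli_rate]. *)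
Definition rate_slope (t : R) : R := bernoulli_gf t + t - 1 + ln (bernoulli_gf t).

Lemma is_derive_rate_slope (t : R) : 0 < t ->
  is_derive rate_slope t (/ t - t * exp t / (exp t - 1) ^ 2).
Proof.
intros Ht; assert (Hp := exp_minus_1_pos t Ht).
assert (Hb := bernoulli_gf_pos t Ht); unfold bernoulli_gf in Hb.
unfold rate_slope, bernoulli_gf; auto_derive.
- repeat split; first [exact Hb|lra].
- field; lra.
Qed.

(** Over the denominator u (e^u - 1)^2 the derivative has numerator (e^u - 1)^2 - (u e^(u/2))^2,
    positive by [mul_exp_half_lt]. *)
Lemma rate_slope_increasing (s t : R) : 0 < s -> s < t -> rate_slope s < rate_slope t.
Proof.
intros Hs Hst.
apply (increasing_derive_pos _ (fun t => / t - t * exp t / (exp t - 1) ^ 2)); auto.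
- intros u Hu; apply is_derive_rate_slope; lra.
- intros u Hu; assert (Hp := exp_minus_1_pos u ltac:(lra)).
  assert (H := mul_exp_half_lt u ltac:(lra)).
  assert (He := exp_pos (u / 2)).
  replace (exp u) with (exp (u / 2) * exp (u / 2)) at 1
    by (rewrite <- exp_plus; f_equal; field).
  replace (/ u - _) with
    (((exp u - 1) ^ 2 - (u * exp (u / 2)) ^ 2) / (u * (exp u - 1) ^ 2)) by (field; lra).
  apply Rdiv_lt_0_compat.
  + assert (0 < u * exp (u / 2)) by nra; nra.
  + apply Rmult_lt_0_compat; [lra|now apply pow_lt].
Qed.

(** A one-sided replacement for the limit 0 at 0+. From g(t) >= e^(-t) >= 1 - t, the logarithm is at
    least -t and the other terms are nonnegative. *)
Lemma rate_slope_ge (t : R) : 0 < t -> - t <= rate_slope t.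
Proof.
intros Ht; assert (Hp := exp_minus_1_pos t Ht).
assert (H : exp (- t) <= bernoulli_gf t).
{ apply (Rmult_le_reg_r (exp t - 1)); [lra|].
  unfold bernoulli_gf; replace (t / (exp t - 1) * (exp t - 1)) with t by (field; lra).
  rewrite Rmult_minus_distr_l, <- exp_plus, Rplus_opp_l, exp_0.
  generalize (exp_ineq1_le (- t)); lra. }
assert (H1 : - t <= ln (bernoulli_gf t)).
{ rewrite <- (ln_exp (- t)); apply ln_le; [apply exp_pos|exact H]. }
unfold rate_slope; generalize (exp_ineq1_le (- t)); lra.
Qed.

Lemma rate_slope_pos (t : R) : 0 < t -> 0 < rate_slope t.
Proof.
intros Ht; assert (H1 := rate_slope_increasing (t / 2) t ltac:(lra) ltac:(lra)).
enough (0 <= rate_slope (t / 2)) by lra.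
apply Rnot_lt_le; intros Hn.
(* So close to 0 the lower bound -s already exceeds the negative value at t/2, against
   monotonicity. *)
set (s := Rmin (t / 4) (- rate_slope (t / 2) / 2)).
assert (Hs : 0 < s) by (apply Rmin_glb_lt; lra).
assert (Hs1 : s <= t / 4) by apply Rmin_l.
assert (Hs2 : s <= - rate_slope (t / 2) / 2) by apply Rmin_r.
assert (H2 := rate_slope_increasing s (t / 2) Hs ltac:(lra)).
assert (H3 := rate_slope_ge s Hs); lra.
Qed.

Lemma is_derive_bernoulli_rate (t : R) : 0 < t ->
  is_derive bernoulli_rate t (rate_slope t / t ^ 2).
Proof.
intros Ht; assert (Hp := exp_minus_1_pos t Ht).
assert (Hb := bernoulli_gf_pos t Ht); unfold bernoulli_gf in Hb.
unfold bernoulli_rate, rate_slope, bernoulli_gf; auto_derive.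
- repeat split; first [exact Hb|lra].
- change (t * / (exp t + - (1))) with (t / (exp t - 1)); field; lra.
Qed.

Lemma bernoulli_rate_increasing (s t : R) : 0 < s -> s < t ->
  bernoulli_rate s < bernoulli_rate t.
Proof.
intros Hs Hst.
apply (increasing_derive_pos _ (fun t => rate_slope t / t ^ 2)); auto.
- intros u Hu; apply is_derive_bernoulli_rate; lra.
- intros u Hu; apply Rdiv_lt_0_compat; [apply rate_slope_pos; lra|apply pow_lt; lra].
Qed.

Lemma bernoulli_rate_IVT (a b c : R) : 0 < a -> 0 < b ->
  bernoulli_rate a <= c -> c <= bernoulli_rate b ->
  exists t0, 0 < t0 /\ bernoulli_rate t0 = c.
Proof.
intros Ha Hb Hac Hcb.
destruct (Rle_lt_or_eq_dec _ _ Hac) as [Hac'|E]; [|now exists a].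
destruct (Rle_lt_or_eq_dec _ _ Hcb) as [Hcb'|E]; [|now exists b].
assert (Hab : a < b).
{ apply Rnot_le_lt; intros [Hba| ->]; [|lra].
  generalize (bernoulli_rate_increasing b a Hb Hba); lra. }
destruct (IVT_interv (fun t => bernoulli_rate t - c) a b) as [t0 [Ht0 E]]; try lra.
- intros t Ht.
  apply derivable_continuous_pt; exists (rate_slope t / t ^ 2).
  apply is_derive_Reals.
  replace (rate_slope t / t ^ 2) with (rate_slope t / t ^ 2 - 0) by ring.
  apply (is_derive_minus (V := R_NormedModule) bernoulli_rate (fun _ => c)).
  + apply is_derive_bernoulli_rate; lra.
  + apply (is_derive_const (V := R_NormedModule)).
- exists t0; split; lra.
Qed.

Lemma exp_lt_exp_mul (a b t : R) : 0 < t -> a < b -> exp (- (b * t)) < exp (- (a * t)).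
Proof. intros Ht Hab; apply exp_increasing; nra. Qed.

(** If the rate stayed on one side of c, the two integrals at x = 0 would differ strictly, yet they
    are equal. *)
Lemma bernoulli_rate_crossing (m : nat) (c : R) : 0 < c ->
  is_int (polygamma_fun m 0) (INR (fact m) / c ^ S m) ->
  exists t0, 0 < t0 /\ bernoulli_rate t0 = c.
Proof.
intros Hc Hl.
assert (Hc' := is_int_pow_exp m c Hc).
assert (Hlt : forall a b t, 0 < t -> a < b ->
  pow_exp m 0 t * exp (- (b * t)) < pow_exp m 0 t * exp (- (a * t))).
{ intros a b t Ht Hab; apply Rmult_lt_compat_l; [now apply pow_exp_pos|].
  now apply exp_lt_exp_mul. }
assert (E : forall t, pow_exp m c t = pow_exp m 0 t * exp (- (c * t))).
{ intros t; rewrite <- pow_exp_shift; now rewrite Rplus_0_l. }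
assert (Ha : exists a, 0 < a /\ bernoulli_rate a <= c).
{ apply Classical_Prop.NNPP; intros Hn.
  apply (Rlt_irrefl (INR (fact m) / c ^ S m)).
  refine (is_int_lt _ _ _ _ (pos_continuous_polygamma_fun m 0)
    (pos_continuous_pow_exp m c) _ Hl Hc').
  intros t Ht; unfold polygamma_fun; rewrite bernoulli_gf_rate, E by exact Ht.
  apply Hlt; auto; apply Rnot_le_lt; intros H; apply Hn; now exists t. }
assert (Hb : exists b, 0 < b /\ c <= bernoulli_rate b).
{ apply Classical_Prop.NNPP; intros Hn.
  apply (Rlt_irrefl (INR (fact m) / c ^ S m)).
  refine (is_int_lt _ _ _ _ (pos_continuous_pow_exp m c)
    (pos_continuous_polygamma_fun m 0) _ Hc' Hl).
  intros t Ht; unfold polygamma_fun; rewrite bernoulli_gf_rate, E by exact Ht.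
  apply Hlt; auto; apply Rnot_le_lt; intros H; apply Hn; now exists t. }
destruct Ha as [a [Ha1 Ha2]]; destruct Hb as [b [Hb1 Hb2]].
now apply (bernoulli_rate_IVT a b).
Qed.

(* At [x = 0] the two integrals agree and the difference of the integrands
   changes sign once, from positive to negative, at [t0]; the decreasing weight
   [exp (- x t)] therefore makes the integral of the difference positive. *)
Lemma polygamma_int_gt (m : nat) (c x l : R) : 0 < c -> 0 < x ->
  is_int (polygamma_fun m 0) (INR (fact m) / c ^ S m) ->
  is_int (polygamma_fun m x) l -> INR (fact m) / (x + c) ^ S m < l.
Proof.
intros Hc Hx H0 Hl.
destruct (bernoulli_rate_crossing m c Hc H0) as [t0 [Ht0 E0]].
assert (Hc0 := is_int_pow_exp m c Hc).
assert (Hcx := is_int_pow_exp m (c + x) ltac:(lra)).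
(* Subtracting e^(-x t0) times the zero difference at x = 0 creates the factor e^(-xt) - e^(-x t0).
   It changes sign at [t0] together with the other factor, so the product is nonnegative. *)
assert (H := is_int_minus _ _ _ _ (is_int_minus _ _ _ _ Hl Hcx)
  (is_int_scal _ (exp (- (x * t0))) _ (is_int_minus _ _ _ _ H0 Hc0))).
set (f := fun t => _) in H.
assert (Ef : forall t, 0 < t -> f t = pow_exp m 0 t *
  ((exp (- (bernoulli_rate t * t)) - exp (- (c * t))) * (exp (- (x * t)) - exp (- (x * t0))))).
{ intros t Ht; unfold f, polygamma_fun.
  rewrite bernoulli_gf_rate by exact Ht.
  replace (pow_exp m x t) with (pow_exp m 0 t * exp (- (x * t)))
    by (now rewrite <- pow_exp_shift, Rplus_0_l).
  rewrite (pow_exp_shift m c x).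
  replace (pow_exp m c t) with (pow_exp m 0 t * exp (- (c * t)))
    by (now rewrite <- pow_exp_shift, Rplus_0_l).
  ring. }
assert (Hpos : forall t, 0 < t -> t <> t0 -> 0 < f t).
{ intros t Ht Hne; rewrite Ef by exact Ht.
  apply Rmult_lt_0_compat; [now apply pow_exp_pos|].
  destruct (Rtotal_order t t0) as [H1|[H1|H1]]; [|contradiction|].
  - assert (Hq := bernoulli_rate_increasing t t0 Ht H1); rewrite E0 in Hq.
    assert (H2 := exp_lt_exp_mul _ _ t Ht Hq).
    assert (H3 : exp (- (x * t0)) < exp (- (x * t))) by (apply exp_increasing; nra).
    apply Rmult_lt_0_compat; lra.
  - assert (Hq := bernoulli_rate_increasing t0 t Ht0 H1); rewrite E0 in Hq.
    assert (H2 := exp_lt_exp_mul _ _ t Ht Hq).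
    assert (H3 : exp (- (x * t)) < exp (- (x * t0))) by (apply exp_increasing; nra).
    apply Rmult_neg_neg; lra. }
assert (Hf : pos_continuous f).
{ intros t Ht; assert (Hp := exp_minus_1_pos t Ht).
  apply (ex_derive_continuous (V := R_NormedModule)).
  unfold f, polygamma_fun, pow_exp, bernoulli_gf; auto_derive; repeat split; lra. }
apply (is_int_gt_0 f _ t0 (t0 + 1)) in H; auto.
- rewrite (Rplus_comm x c); lra.
- intros t Ht; destruct (Req_dec t t0) as [-> |Hne]; [|left; now apply Hpos].
  rewrite Ef, Rminus_diag by exact Ht; right; ring.
- lra.
- intros t Ht; apply Hpos; lra.
Qed.

Lemma polygamma_int_ge (m : nat) (x l : R) : 0 < x ->
  is_int (polygamma_fun m x) l ->
  INR (fact m) / x ^ S m * (1 - INR (S m) / (2 * x)) <= l.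
Proof.
intros Hx Hl.
assert (H := is_int_minus _ _ _ _ (is_int_pow_exp m x Hx)
  (is_int_scal _ (/ 2) _ (is_int_pow_exp (S m) x Hx))).
replace (INR (fact m) / x ^ S m * (1 - INR (S m) / (2 * x)))
  with (INR (fact m) / x ^ S m - / 2 * (INR (fact (S m)) / x ^ S (S m))).
- refine (is_int_le _ _ _ _ _ (pos_continuous_polygamma_fun m x) _ H Hl).
  + intros t Ht; apply (ex_derive_continuous (V := R_NormedModule)).
    unfold pow_exp; auto_derive; auto.
  + intros t Ht; assert (Hb := bernoulli_gf_ge t Ht).
    assert (Hp := pow_exp_pos m x t Ht).
    replace (pow_exp (S m) x t) with (pow_exp m x t * t) by (unfold pow_exp; simpl; ring).
    unfold polygamma_fun; nra.
- rewrite fact_simpl, mult_INR; simpl (x ^ S (S m)); simpl (x ^ S m); field.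
  split; [lra|apply pow_nonzero; lra].
Qed.

Theorem corollary1 :
  forall k : nat, (1 <= k)%nat ->
    (forall x : R, 0 < x ->
       INR (fact (k - 1)) / (x + lower_shift k) ^ k < Rabs (polygamma k (x + 1)) /\
       Rabs (polygamma k (x + 1)) < INR (fact (k - 1)) / (x + 1 / 2) ^ k) /\
    (forall alpha : R, 0 <= alpha ->
       (forall x : R, 0 < x ->
          INR (fact (k - 1)) / (x + alpha) ^ k < Rabs (polygamma k (x + 1))) ->
       lower_shift k <= alpha) /\
    (forall beta : R, 0 <= beta ->
       (forall x : R, 0 < x ->
          Rabs (polygamma k (x + 1)) < INR (fact (k - 1)) / (x + beta) ^ k) ->
       beta <= 1 / 2).
Proof.
intros k Hk; destruct k as [|m]; [lia|]; clear Hk.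
unfold lower_shift; rewrite Nat.sub_succ, Nat.sub_0_r.
assert (HI : forall x, 0 <= x -> is_int (polygamma_fun m x) (Rabs (polygamma (S m) (x + 1)))).
{ intros x Hx; apply is_int_Rabs_polygamma; lra. }
assert (H0 := HI 0 ltac:(lra)); rewrite Rplus_0_l in H0.
set (J0 := Rabs (polygamma (S m) 1)) in *.
assert (HJ0 : 0 < J0).
{ apply (is_int_gt_0 (polygamma_fun m 0) J0 1 2); auto; try lra.
  - apply pos_continuous_polygamma_fun.
  - intros t Ht; left; now apply polygamma_fun_pos.
  - intros t Ht; apply polygamma_fun_pos; lra. }
assert (Hfact := INR_fact_lt_0 m).
set (c := Rpower (INR (fact m) / J0) (1 / INR (S m))).
assert (Hc : 0 < c) by apply exp_pos.
(* The shift is exactly the value of c that makes the two integrals agree at x = 0. *)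
assert (HJc : J0 = INR (fact m) / c ^ S m).
{ assert (Hm : 0 < INR (S m)) by (apply lt_0_INR; lia).
  unfold c; rewrite <- Rpower_pow, Rpower_mult by apply exp_pos.
  replace (1 / INR (S m) * INR (S m)) with 1 by (field; lra).
  rewrite Rpower_1 by (apply Rdiv_lt_0_compat; lra); field; lra. }
split; [|split].
- intros x Hx; split.
  + apply polygamma_int_gt; auto; [now rewrite <- HJc|apply HI; lra].
  + refine (is_int_lt _ _ _ _ (pos_continuous_polygamma_fun m x)
      (pos_continuous_pow_exp m (x + 1 / 2)) _ (HI x ltac:(lra))
      (is_int_pow_exp m (x + 1 / 2) ltac:(lra))).
    intros t Ht; now apply polygamma_fun_lt.
- intros alpha Ha H; apply Rnot_lt_le; intros Hlt.
  (* Then x + alpha is the midpoint of alpha and c, so the assumed lower bound at x is at least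
     [J0], while the polygamma value is at most [J0]. *)
  set (x := (c - alpha) / 2).
  assert (Hx : 0 < x) by (unfold x; lra).
  specialize (H x Hx).
  assert (Hle : Rabs (polygamma (S m) (x + 1)) <= J0).
  { refine (is_int_le _ _ _ _ (pos_continuous_polygamma_fun m x)
      (pos_continuous_polygamma_fun m 0) _ (HI x ltac:(lra)) H0).
    intros t Ht; apply Rmult_le_compat_r; [left; now apply bernoulli_gf_pos|].
    apply Rmult_le_compat_l; [left; now apply pow_lt|].
    left; now apply exp_lt_exp_mul. }
  assert (Hge : INR (fact m) / c ^ S m <= INR (fact m) / (x + alpha) ^ S m).
  { apply Rmult_le_compat_l; [lra|].
    apply Rinv_le_contravar; [apply pow_lt; lra|apply pow_incr; unfold x; lra]. }
  lra.
- intros beta Hb H; apply Rnot_lt_le; intros Hlt.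
  set (K := INR (S m)).
  assert (HK : 0 < K) by (apply lt_0_INR; lia).
  (* The bound from [polygamma_int_ge] and Bernoulli's inequality for (1 + beta/x)^K lead to x^2 + K
     (x (beta - 1/2) - K beta/2) < x^2. This x is twice the threshold at which the bracket
     vanishes. *)
  set (x := K * beta / (beta - 1 / 2)).
  assert (Hx : 0 < x) by (apply Rdiv_lt_0_compat; nra).
  assert (Hxb : x * (beta - 1 / 2) = K * beta) by (unfold x; field; lra).
  specialize (H x Hx).
  assert (Hge := polygamma_int_ge m x _ Hx (HI x ltac:(lra))); fold K in Hge.
  assert (Hy : 0 < beta / x) by (apply Rdiv_lt_0_compat; lra).
  assert (Hb1 := poly (S m) (beta / x) Hy); fold K in Hb1.
  assert (HP : 0 < x ^ S m) by now apply pow_lt.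
  assert (HQ : 0 < (1 + beta / x) ^ S m).
  { apply pow_lt; lra. }
  replace ((x + beta) ^ S m) with (x ^ S m * (1 + beta / x) ^ S m) in H
    by (rewrite <- Rpow_mult_distr; f_equal; field; lra).
  assert (H1 : INR (fact m) / x ^ S m * (1 - K / (2 * x))
    < INR (fact m) / x ^ S m * / (1 + beta / x) ^ S m).
  { apply Rle_lt_trans with (1 := Hge); apply Rlt_le_trans with (1 := H).
    right; field; lra. }
  apply Rmult_lt_reg_l in H1; [|apply Rdiv_lt_0_compat; lra].
  apply (Rmult_lt_compat_r ((1 + beta / x) ^ S m)) in H1; [|exact HQ].
  rewrite Rinv_l in H1 by lra.
  (* Here x > K, so the factor 1 - K/(2x) is positive and Bernoulli's inequality may be multiplied
     by it. *)
  assert (H2 : K / (2 * x) < 1).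
  { apply (Rmult_lt_reg_r (2 * x)); [lra|].
    replace (K / (2 * x) * (2 * x)) with K by (field; lra); nra. }
  assert (H3 : (1 - K / (2 * x)) * (1 + K * (beta / x)) < 1).
  { apply Rle_lt_trans with (2 := H1); apply Rmult_le_compat_l; lra. }
  apply (Rmult_lt_compat_r (x * x)) in H3; [|nra].
  replace ((1 - K / (2 * x)) * (1 + K * (beta / x)) * (x * x))
    with (x * x + K * (x * (beta - 1 / 2) - K * beta / 2)) in H3 by (field; lra).
  rewrite Hxb in H3; nra.
Qed.
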